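(* Work in the setting described in the context. Assume: (i) (Convexity) for every $\omega\in\Omega$ the map $\beta\mapsto L(f_\beta,\omega)$ is convex on $\mathbb{R}^p$; (ii) (Quadratic margin) there are a constant $c>0$ and a subset $\mathbf{F}_{\mathrm{local}}\subset\mathbf{F}$ such that $\mathcal{E}(f)\ge c\|f-f^0\|^2$ for all $f\in\mathbf{F}_{\mathrm{local}}$; (iii) the positive eigenvalue condition is satisfied with constant $\tau>0$; (iv) the $(3C/\tau^2,S_* )$-compatibility condition is satisfied with constant $\phi_*>0$. Let $\lambda>0$ and set $$\varepsilon_\lambda=4\mathcal{E}(f^* )+\frac{12}{c\phi_*^2}\left(1+\frac{3C}{\tau^2}\right)^2 s_*\lambda^2,\qquad M_\lambda=\frac{\varepsilon_\lambda}{\lambda}.$$ Suppose further that $f_\beta\in\mathbf{F}_{\mathrm{local}}$ for every $\beta\in\mathbb{R}^p$ with $\|\beta-\beta^*\|_1\le M_\lambda$. Then, on the set $\{\mathbf{Z}_{M_\lambda}\le\varepsilon_\lambda\}$, $$\|\hat\beta-\beta^*\|_1\le M_\lambda=\frac{4}{\lambda}\mathcal{E}(f^* )+\frac{12}{c\phi_*^2}\left(1+\frac{3C}{\tau^2}\right)^2 s_*\lambda$$ and $$\mathcal{E}(\hat f)\le\frac54\varepsilon_\lambda=5\mathcal{E}(f^* )+\frac{15}{c\phi_*^2}\left(1+\frac{3C}{\tau^2}\right)^2 s_*\lambda^2.$$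
   Context: Let $(\Omega,\mathcal{F},P)$ be a probability space, $\mathbf{F}$ a real inner product space with inner product $\langle\cdot,\cdot\rangle$ and norm $\|\cdot\|$, and $L:\mathbf{F}\times\Omega\to\mathbb{R}$ a function (the empirical loss) such that $L(f)=L(f,\cdot)\in L^1(P)$ for every $f\in\mathbf{F}$. Put $\bar L(f)=E[L(f)]$. Assume there exists $f^0\in\mathbf{F}$ with $\bar L(f^0)=\min_{f\in\mathbf{F}}\bar L(f)$, fix such an $f^0$, and define the excess risk $\mathcal{E}(f)=\bar L(f)-\bar L(f^0)\ge 0$. Let $\psi_1,\dots,\psi_p\in\mathbf{F}$. For $\beta\in\mathbb{R}^p$ put $f_\beta=\sum_{j=1}^p\beta_j\psi_j$. Write $\beta\succeq0$ if $\beta_j\ge0$ for all $j$; $\|\beta\|_1=\sum_j|\beta_j|$; for $S\subset\{1,\dots,p\}$, $\beta_S\in\mathbb{R}^p$ is the vector with $j$-th entry $\beta_j1_{\{j\in S\}}$. The estimator $\hat\beta$ is a non-negatively constrained minimizer of the empirical loss: $\hat\beta\succeq0$ and $L(f_{\hat\beta})=\min_{\beta\succeq0}L(f_\beta)$; put $\hat f=f_{\hat\beta}$. Fix a vector $\beta^*\in\mathbb{R}^p$ with $\beta^*\succeq0$. Put $f^*=f_{\beta^*}$, $S_*=\{j:\beta^*_j\ne0\}$, $s_*=|S_*|$, $C=\max_{1\le j\le p}\|\psi_j\|^2$. Put $v(\beta)=L(f_\beta)-\bar L(f_\beta)$ and, for $M>0$, $\mathbf{Z}_M=\sup_{\beta\in\mathbb{R}^p:\|\beta-\beta^*\|_1\le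 M}|v(\beta)-v(\beta^* )|$. Let $\Sigma=(\langle\psi_i,\psi_j\rangle)_{1\le i,j\le p}$ be the Gram matrix. Compatibility condition: for $S\subset\{1,\dots,p\}$ and $\Lambda\ge0$, the $(\Lambda,S)$-compatibility condition is satisfied with constant $\phi>0$ if $|S|\,\beta^\top\Sigma\beta\ge\phi^2$ for all $\beta\in\mathbb{R}^p$ with $\|\beta_S\|_1=1$ and $\|\beta_{S^c}\|_1\le \Lambda$. Positive eigenvalue condition: it is satisfied with constant $\tau>0$ if $\beta^\top\Sigma\beta\ge\tau^2$ for all $\beta\in\mathbb{R}^p$ with $\|\beta\|_1=1$ and $\beta\succeq0$.
   Formalization: The formal theorem additionally assumes that S_* is nonempty (β* ≠ 0); for empty S_* the compatibility condition is vacuous and the claim is false, e.g. p=1, ψ_1=1, β*=0, L(f)=(f-1)²-af with a=±10, λ=10. *)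

(* Defs.v *)
From HB Require Import structures.
From mathcomp Require Import all_boot all_order all_algebra.
From mathcomp Require Import all_classical all_reals all_analysis.

Set Implicit Arguments.
Unset Strict Implicit.
Unset Printing Implicit Defensive.

Import Order.TTheory GRing.Theory Num.Theory.

Local Open Scope classical_set_scope.
Local Open Scope ring_scope.

Definition dotnorm (R : realType) (F : lmodType R) (dot : {dot F for idfun})
    (f : F) : R :=
  Num.sqrt (dot f f).

Definition lincomb (R : realType) (F : lmodType R) (p : nat) (psi : 'I_p -> F)
    (b : 'cV[R]_p) : F :=
  \sum_(j < p) b j 0 *: psi j.

Definition vec_ge0 (R : realType) (p : nat) (b : 'cV[R]_p) : Prop :=
  forall j, 0 <= b j 0.

(* Not the matrix norm `|b|, which is the sup norm. *)
Definition l1norm (R : realType) (p : nat) (b : 'cV[R]_p) : R :=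
  \sum_(j < p) `|b j 0|.

Definition restrict_vec (R : realType) (p : nat) (S : {set 'I_p})
    (b : 'cV[R]_p) : 'cV[R]_p :=
  \col_j (if j \in S then b j 0 else 0).

Definition supp_vec (R : realType) (p : nat) (b : 'cV[R]_p) : {set 'I_p} :=
  [set j | b j 0 != 0].

Definition gram (R : realType) (F : lmodType R) (dot : {dot F for idfun})
    (p : nat) (psi : 'I_p -> F) : 'M[R]_p :=
  \matrix_(i, j) dot (psi i) (psi j).

(* The base value 0 does not change the maximum, since the squared norms are
   nonnegative; it only fixes the value when p = 0. *)
Definition max_sqnorm (R : realType) (F : lmodType R) (dot : {dot F for idfun})
    (p : nat) (psi : 'I_p -> F) : R :=
  \big[Num.max/0]_(j < p) dotnorm dot (psi j) ^+ 2.

Definition compatibility (R : realType) (p : nat) (Sigma : 'M[R]_p)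
    (Lambda : R) (S : {set 'I_p}) (phi : R) : Prop :=
  forall b : 'cV[R]_p,
    l1norm (restrict_vec S b) = 1 -> l1norm (restrict_vec (~: S)%SET b) <= Lambda ->
    phi ^+ 2 <= #|S|%:R * (b^T *m Sigma *m b) 0 0.

Definition positive_eigenvalue (R : realType) (p : nat) (Sigma : 'M[R]_p)
    (tau : R) : Prop :=
  forall b : 'cV[R]_p,
    l1norm b = 1 -> vec_ge0 b -> tau ^+ 2 <= (b^T *m Sigma *m b) 0 0.

(* [fine] loses nothing here: L f is assumed integrable wherever this is used,
   so its expectation is finite. *)
Definition risk (d : measure_display) (T : measurableType d) (R : realType)
    (P : probability T R) (F : lmodType R) (L : F -> T -> R) (f : F) : R :=
  fine ('E_P[L f])%E.

Definition excess_risk (d : measure_display) (T : measurableType d)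
    (R : realType) (P : probability T R) (F : lmodType R) (L : F -> T -> R)
    (f0 f : F) : R :=
  risk P L f - risk P L f0.

Definition quadratic_margin (d : measure_display) (T : measurableType d)
    (R : realType) (P : probability T R) (F : lmodType R)
    (dot : {dot F for idfun}) (L : F -> T -> R) (f0 : F) (c : R)
    (Flocal : set F) : Prop :=
  forall f, Flocal f -> c * dotnorm dot (f - f0) ^+ 2 <= excess_risk P L f0 f.

Definition nonneg_minimizer (T : Type) (R : realType) (F : lmodType R)
    (L : F -> T -> R) (p : nat) (psi : 'I_p -> F) (w : T) (b : 'cV[R]_p)
    : Prop :=
  vec_ge0 b /\
  forall b' : 'cV[R]_p, vec_ge0 b' -> L (lincomb psi b) w <= L (lincomb psi b') w.

Definition emp_process (d : measure_display) (T : measurableType d)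
    (R : realType) (P : probability T R) (F : lmodType R) (L : F -> T -> R)
    (p : nat) (psi : 'I_p -> F) (b : 'cV[R]_p) (w : T) : R :=
  L (lincomb psi b) w - risk P L (lincomb psi b).

(* Extended-real valued, since the supremum may be infinite. *)
Definition emp_process_sup (d : measure_display) (T : measurableType d)
    (R : realType) (P : probability T R) (F : lmodType R) (L : F -> T -> R)
    (p : nat) (psi : 'I_p -> F) (bstar : 'cV[R]_p) (M : R) (w : T) : \bar R :=
  ereal_sup
    [set `|emp_process P L psi b w - emp_process P L psi bstar w|%:E |
       b in [set b : 'cV[R]_p | l1norm (b - bstar) <= M]].

(* Main.v *)
Require Import Defs.
From HB Require Import structures.
From mathcomp Require Import all_boot all_order all_algebra.
From mathcomp Require Import all_classical all_reals all_analysis.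
From mathcomp Require Import ring lra.

Set Implicit Arguments.
Unset Strict Implicit.
Unset Printing Implicit Defensive.

Import Order.TTheory GRing.Theory Num.Theory.

Local Open Scope classical_set_scope.
Local Open Scope ring_scope.

(** Write [f_b] for [lincomb psi b]. The proof has a geometric half and a
localization half.

Geometry: [l1norm_le_dotnorm] shows that the two conditions on the Gram matrix
together give [phi * |b|_1 <= (1 + 3C/tau^2) * sqrt |S| * ||f_b||] for every [b]
that is nonnegative off [S]. If the [l1] mass of [b] off [S] is at most
[3C/tau^2] times its mass on [S], this is the compatibility condition. Otherwise
the off-support part [b_c] dominates: the positive eigenvalue condition gives
[||f_(b_c)|| >= tau * |b_c|_1], and the factor 3 makes the on-support part,
whose norm is at most [sqrt C * |b_S|_1], too small to cancel it. The bound
obtained then has no [phi] in it, and is compared with the claimed one through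
[phi <= sqrt |S| * sqrt C] ([compatibility_le_max]) and [tau <= sqrt C]
([positive_eigenvalue_le_max]), both read off from a coordinate vector. It
applies to [b - bstar] for every nonnegative [b], because [bstar] vanishes off
its support.

Localization: if a nonnegative [b] in the [l1] ball of radius [M] around [bstar]
has empirical loss at most that of [bstar], then control of the empirical
process gives [E f_b <= E f_bstar + eps] ([excess_risk_le_of_loss_le]); the
quadratic margin turns this into a bound on [||f_b - f_bstar||], geometry turns
that into a bound on [|b - bstar|_1], and the constants in [eps] are such that
the bound is [M / 2] ([half_radius_of_margin]). The estimator is not known to
lie in the ball, so this is applied to the point [t * bhat + (1 - t) * bstar],
[t = M / (M + |bhat - bstar|_1)], whose loss is small by convexity. It lies at
distance [t * |bhat - bstar|_1] from [bstar], and that this is at most [M / 2]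
means exactly [|bhat - bstar|_1 <= M]. So the estimator is in the ball after
all, and [E f_bhat <= E f_bstar + eps <= 5/4 eps] since [4 * E f_bstar <= eps]. *)

(** * Real inner product norms *)

Section DotNorm.
Variables (R : realType) (F : lmodType R) (dot : {dot F for idfun}).
Implicit Types (u v : F) (a : R).

Lemma dotC u v : dot u v = dot v u.
Proof. by rewrite hermC /= expr0 mul1r. Qed.

Lemma dot_ge0 u : 0 <= dot u u.
Proof.
have [->|u0] := eqVneq u 0; first by rewrite linear0r.
exact/ltW/neq0_dnorm_gt0.
Qed.

Lemma dotnorm_ge0 u : 0 <= dotnorm dot u.
Proof. exact: sqrtr_ge0. Qed.

Lemma sqr_dotnorm u : dotnorm dot u ^+ 2 = dot u u.
Proof. by rewrite sqr_sqrtr ?dot_ge0. Qed.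

Lemma dotnorm0 : dotnorm dot 0 = 0.
Proof. by rewrite /dotnorm linear0r sqrtr0. Qed.

Lemma dotnorm_eq0 u : dotnorm dot u = 0 -> u = 0.
Proof.
have [//|u0] := eqVneq u 0 => /eqP; rewrite sqrtr_eq0.
by rewrite leNgt neq0_dnorm_gt0.
Qed.

Lemma dotnormZ a u : dotnorm dot (a *: u) = `|a| * dotnorm dot u.
Proof.
rewrite /dotnorm linearZl_LR linearZr_LR /= mulrA -expr2.
by rewrite sqrtrM ?sqr_ge0// sqrtr_sqr.
Qed.

Lemma dotnormN u : dotnorm dot (- u) = dotnorm dot u.
Proof. by rewrite -scaleN1r dotnormZ normrN1 mul1r. Qed.

(** The square norm of [||v|| u - ||u|| v] is
[2 ||u|| ||v|| (||u|| ||v|| - dot u v)]; when a norm vanishes there is nothing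
to divide by, but then the vector itself is zero. *)
Lemma Cauchy_Schwarz_dot u v : dot u v <= dotnorm dot u * dotnorm dot v.
Proof.
set x := dotnorm dot u; set y := dotnorm dot v.
have [x0|x0] := eqVneq x 0.
  by rewrite (dotnorm_eq0 x0) linear0l x0 mul0r.
have [y0|y0] := eqVneq y 0.
  by rewrite (dotnorm_eq0 y0) linear0r y0 mulr0.
have xy0 : 0 < x * y by rewrite mulr_gt0 // lt_def ?x0 ?y0 dotnorm_ge0.
have := dot_ge0 (y *: u - x *: v).
rewrite linearBl !linearBr /= !linearZl_LR !linearZr_LR /= (dotC v u).
rewrite -!sqr_dotnorm -/x -/y.
rewrite [X in 0 <= X](_ : _ = 2 * (x * y) * (x * y - dot u v) :> R); last first.
  by rewrite /GRing.scale /=; ring.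
by rewrite pmulr_rge0 ?subr_ge0 // mulr_gt0.
Qed.

Lemma dotnormD u v : dotnorm dot (u + v) <= dotnorm dot u + dotnorm dot v.
Proof.
rewrite -ler_sqr ?nnegrE ?addr_ge0 ?dotnorm_ge0//.
rewrite sqr_dotnorm linearDl !linearDr /= (dotC v u) sqrrD -!sqr_dotnorm.
by have := Cauchy_Schwarz_dot u v; lra.
Qed.

End DotNorm.

(** * The l1 norm and coordinate restriction *)

Section L1Norm.
Variables (R : realType) (p : nat).
Implicit Types (b : 'cV[R]_p) (S : {set 'I_p}).

Lemma l1norm_ge0 b : 0 <= l1norm b.
Proof. exact: sumr_ge0. Qed.

Lemma l1normZ a b : l1norm (a *: b) = `|a| * l1norm b.
Proof. by rewrite /l1norm mulr_sumr; apply: eq_bigr => j _; rewrite mxE normrM. Qed.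

Lemma restrict_vecE S b j :
  restrict_vec S b j 0 = if j \in S then b j 0 else 0.
Proof. by rewrite mxE. Qed.

Lemma restrict_vecZ S a b : restrict_vec S (a *: b) = a *: restrict_vec S b.
Proof. by apply/colP => j; rewrite !mxE; case: ifP; rewrite ?mulr0. Qed.

Lemma restrict_vecDC S b :
  restrict_vec S b + restrict_vec (~: S)%SET b = b.
Proof.
by apply/colP => j; rewrite !mxE inE; case: (j \in S); rewrite ?addr0 ?add0r.
Qed.

Lemma l1norm_restrictDC S b :
  l1norm (restrict_vec S b) + l1norm (restrict_vec (~: S)%SET b) = l1norm b.
Proof.
rewrite /l1norm -big_split; apply: eq_bigr => j _ /=.
by rewrite !restrict_vecE inE; case: (j \in S); rewrite /= normr0 ?addr0 ?add0r.
Qed.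

Lemma l1norm_delta j : l1norm (delta_mx j 0 : 'cV[R]_p) = 1.
Proof.
rewrite /l1norm (bigD1 j) //= big1 ?addr0 => [|k /negPf kj].
  by rewrite mxE !eqxx normr1.
by rewrite mxE kj normr0.
Qed.

Lemma restrict_delta S j : restrict_vec S (delta_mx j 0 : 'cV[R]_p) =
  if j \in S then delta_mx j 0 else 0.
Proof.
apply/colP => k; rewrite !mxE.
case: (eqVneq k j) => [->|kj]; first by case: ifP => _; rewrite !mxE ?eqxx.
by case: ifP => _; case: ifP => _; rewrite !mxE // (negPf kj).
Qed.

End L1Norm.

(** * Linear combinations and the conditions on the Gram matrix *)

Section Dictionary.
Variables (R : realType) (F : lmodType R) (dot : {dot F for idfun}).
Variables (p : nat) (psi : 'I_p -> F).
Implicit Types (b : 'cV[R]_p) (S : {set 'I_p}).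
Local Notation nrm := (dotnorm dot).
Local Notation f_ := (lincomb psi).
Local Notation C := (max_sqnorm dot psi).

Lemma lincombD b1 b2 : f_ (b1 + b2) = f_ b1 + f_ b2.
Proof.
by rewrite /lincomb -big_split; apply: eq_bigr => j _; rewrite mxE scalerDl.
Qed.

Lemma lincombZ a b : f_ (a *: b) = a *: f_ b.
Proof.
by rewrite /lincomb scaler_sumr; apply: eq_bigr => j _; rewrite mxE scalerA.
Qed.

Lemma lincombB b1 b2 : f_ (b1 - b2) = f_ b1 - f_ b2.
Proof. by rewrite lincombD -(scaleN1r b2) lincombZ scaleN1r. Qed.

Lemma gram_quadform b : (b^T *m gram dot psi *m b) 0 0 = nrm (f_ b) ^+ 2.
Proof.
rewrite sqr_dotnorm {2}/lincomb linear_sumr mxE; apply: eq_bigr => j _ /=.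
rewrite linearZr_LR /= mulrC; congr (_ * _).
rewrite /lincomb linear_sumlz mxE; apply: eq_bigr => i _ /=.
by rewrite linearZl_LR !mxE.
Qed.

Lemma sqr_dotnorm_le_max j : nrm (psi j) ^+ 2 <= C.
Proof. by rewrite /max_sqnorm (le_bigmax _ (fun j => nrm (psi j) ^+ 2)). Qed.

Lemma max_sqnorm_ge0 : 0 <= C.
Proof. exact: bigmax_ge_id. Qed.

Lemma dotnorm_lincomb_le b : nrm (f_ b) <= Num.sqrt C * l1norm b.
Proof.
rewrite /lincomb /l1norm mulr_sumr.
elim/big_ind2: _ => [|x1 x2 y1 y2 h1 h2|j _]; first by rewrite dotnorm0.
  exact: le_trans (dotnormD _ _ _) (lerD _ _).
rewrite dotnormZ mulrC ler_wpM2r // -ler_sqr ?nnegrE ?dotnorm_ge0 ?sqrtr_ge0//.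
by rewrite (sqr_sqrtr max_sqnorm_ge0) sqr_dotnorm_le_max.
Qed.

(** Homogeneous form of the positive eigenvalue condition, free of the
normalization of [b]. *)
Lemma positive_eigenvalue_dotnorm tau b : 0 < tau ->
  positive_eigenvalue (gram dot psi) tau -> vec_ge0 b ->
  tau * l1norm b <= nrm (f_ b).
Proof.
move=> tau0 eig b0.
have [n0|n0] := eqVneq (l1norm b) 0; first by rewrite n0 mulr0 dotnorm_ge0.
have n1 : 0 < l1norm b by rewrite lt_def n0 l1norm_ge0.
have nV : 0 < (l1norm b)^-1 by rewrite invr_gt0.
have := eig ((l1norm b)^-1 *: b).
rewrite l1normZ gtr0_norm // mulVf // gram_quadform lincombZ => /(_ erefl).
have bV0 : vec_ge0 ((l1norm b)^-1 *: b).
  by move=> j; rewrite mxE mulr_ge0 // ltW.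
move=> /(_ bV0); rewrite ler_sqr ?nnegrE ?dotnorm_ge0 ?(ltW tau0) //.
by rewrite dotnormZ gtr0_norm // mulrC ler_pdivlMr.
Qed.

(** Homogeneous form of the compatibility condition. When [b] vanishes on [S]
it cannot be normalized, but the inequality is then trivial. *)
Lemma compatibility_dotnorm Lambda S phi b : 0 < phi ->
  compatibility (gram dot psi) Lambda S phi ->
  l1norm (restrict_vec (~: S)%SET b) <= Lambda * l1norm (restrict_vec S b) ->
  phi * l1norm (restrict_vec S b) <= Num.sqrt #|S|%:R * nrm (f_ b).
Proof.
move=> phi0 compat bS; set n := l1norm (restrict_vec S b) in bS *.
have [n0|n0] := eqVneq n 0.
  by rewrite n0 mulr0 mulr_ge0 ?sqrtr_ge0 ?dotnorm_ge0.
have n1 : 0 < n by rewrite lt_def n0 l1norm_ge0.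
have nV : 0 < n^-1 by rewrite invr_gt0.
have := compat (n^-1 *: b).
rewrite !restrict_vecZ !l1normZ gtr0_norm // -/n mulVf // => /(_ erefl).
rewrite mulrC ler_pdivrMr // => /(_ bS).
rewrite gram_quadform lincombZ dotnormZ gtr0_norm //.
rewrite -[X in X * _](@sqr_sqrtr _ #|S|%:R) // -exprMn.
rewrite ler_sqr ?nnegrE ?(mulr_ge0, sqrtr_ge0, dotnorm_ge0) ?(ltW phi0, ltW nV) //.
by rewrite mulrCA mulrC ler_pdivlMr.
Qed.

(** Compatibility tested on a coordinate vector of [S]: an upper bound on [phi],
which makes bounds that do not mention [phi] comparable with those that do. *)
Lemma compatibility_le_max Lambda S phi j : 0 <= Lambda -> 0 < phi -> j \in S ->
  compatibility (gram dot psi) Lambda S phi ->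
  phi <= Num.sqrt #|S|%:R * Num.sqrt C.
Proof.
move=> L0 phi0 jS compat.
have := compatibility_dotnorm (b := delta_mx j 0) phi0 compat.
rewrite !restrict_delta inE jS /= l1norm_delta !mulr1 => h.
apply: le_trans (h _) _; first by rewrite /l1norm big1 // => k _; rewrite mxE normr0.
rewrite ler_wpM2l ?sqrtr_ge0 //.
by have := dotnorm_lincomb_le (delta_mx j 0); rewrite l1norm_delta mulr1.
Qed.

Lemma positive_eigenvalue_le_max tau (j : 'I_p) : 0 < tau ->
  positive_eigenvalue (gram dot psi) tau -> tau <= Num.sqrt C.
Proof.
move=> tau0 eig.
have d0 : vec_ge0 (delta_mx j 0 : 'cV[R]_p) by move=> k; rewrite mxE ler0n.
have := le_trans (positive_eigenvalue_dotnorm tau0 eig d0) (dotnorm_lincomb_le _).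
by rewrite l1norm_delta !mulr1.
Qed.

(** The geometric core: off [S] the sign constraint replaces compatibility. With
[r = sqrt C / tau >= 1], if [|b_c|_1 > 3 r^2 |b_S|_1] then
[||f_b|| >= tau |b_c|_1 - tau r |b_S|_1 >= (2/3) tau |b_c|_1], whence
[tau |b|_1 <= 2 ||f_b||]; the claim follows from [phi <= sqrt |S| * tau * r] and
[2 r <= 1 + 3 r^2]. *)
Lemma l1norm_le_dotnorm S (tau phi : R) b : S != finset.set0 ->
  0 < tau -> positive_eigenvalue (gram dot psi) tau ->
  0 < phi -> compatibility (gram dot psi) (3 * C / tau ^+ 2) S phi ->
  (forall j, j \notin S -> 0 <= b j 0) ->
  phi * l1norm b <=
    (1 + 3 * C / tau ^+ 2) * Num.sqrt #|S|%:R * nrm (f_ b).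
Proof.
move=> /set0Pn[j jS] tau0 eig phi0 compat bSC0.
set Lam := 3 * C / tau ^+ 2 in compat *.
have C0 := max_sqnorm_ge0.
have Lam0 : 0 <= Lam by rewrite divr_ge0 ?sqr_ge0 ?mulr_ge0.
set q := Num.sqrt #|S|%:R.
have q0 : 0 <= q by exact: sqrtr_ge0.
rewrite -(l1norm_restrictDC S b).
set x := l1norm (restrict_vec S b); set y := l1norm (restrict_vec (~: S)%SET b).
have x0 : 0 <= x := l1norm_ge0 _.
have y0 : 0 <= y := l1norm_ge0 _.
have [yx|xy] := leP y (Lam * x).
  have hx : phi * x <= q * nrm (f_ b) := compatibility_dotnorm phi0 compat yx.
  apply: (@le_trans _ _ ((1 + Lam) * (phi * x))).
    rewrite mulrCA ler_wpM2l ?(ltW phi0) //; lra.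
  by rewrite -mulrA ler_wpM2l // addr_ge0.
have hphi : phi <= q * Num.sqrt C := compatibility_le_max Lam0 phi0 jS compat.
have htau := positive_eigenvalue_le_max j tau0 eig.
pose r := Num.sqrt C / tau.
have r1 : 1 <= r by rewrite ler_pdivlMr // mul1r.
have LamE : Lam = 3 * r ^+ 2.
  by rewrite /Lam /r -{1}(sqr_sqrtr C0) expr_div_n -mulrA.
have sqrtCE : Num.sqrt C = tau * r by rewrite /r mulrCA divff ?gt_eqF // mulr1.
clearbody r.
have hy : tau * y <= nrm (f_ b) + tau * r * x.
  have bSC : vec_ge0 (restrict_vec (~: S)%SET b).
    by move=> k; rewrite restrict_vecE inE; case: ifP => // /bSC0.
  apply: le_trans (positive_eigenvalue_dotnorm tau0 eig bSC) _.
  rewrite -(addKr (restrict_vec S b) (restrict_vec (~: S)%SET b)).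
  rewrite restrict_vecDC addrC lincombB.
  apply: le_trans (dotnormD _ _ _) _; rewrite dotnormN lerD2l -sqrtCE.
  exact: dotnorm_lincomb_le.
have n0 := dotnorm_ge0 dot (f_ b).
(* [r <= r^2] turns the case hypothesis [3 r^2 x < y] into a linear one. *)
have hrx : 3 * (r * x) <= y.
  apply: le_trans (ltW xy); rewrite LamE -mulrA ler_wpM2l // expr2 -mulrA.
  by rewrite ler_peMl // mulr_ge0 // (le_trans _ r1).
have hxy : tau * (x + y) <= 2 * nrm (f_ b).
  have xr : x <= r * x by rewrite ler_peMl.
  have : tau * (3 * (r * x)) <= tau * y by rewrite ler_wpM2l // ltW.
  have : tau * x <= tau * (r * x) by rewrite ler_wpM2l // ltW.
  lra.
apply: (@le_trans _ _ (q * r * (2 * nrm (f_ b)))); last first.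
  rewrite LamE [(1 + _) * q]mulrC -!mulrA ler_wpM2l // mulrA ler_wpM2r //.
  by have := sqr_ge0 r; have := sqr_ge0 (r - 1); lra.
apply: le_trans (_ : q * r * (tau * (x + y)) <= _); last first.
  by rewrite ler_wpM2l // mulr_ge0 // (le_trans _ r1).
by rewrite mulrA ler_wpM2r ?addr_ge0 // -mulrA [r * _]mulrC -sqrtCE.
Qed.

End Dictionary.

(** * Localization *)

Lemma young_ineq (R : realFieldType) (c k a x : R) : 0 < c -> 0 < k ->
  a * x <= k * (a ^+ 2 / c) + c * x ^+ 2 / (4 * k).
Proof.
move=> c0 k0; rewrite -subr_ge0.
have -> : k * (a ^+ 2 / c) + c * x ^+ 2 / (4 * k) - a * x =
          (2 * k * a - c * x) ^+ 2 / (4 * k * c).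
  by field; rewrite !gt_eqF.
by rewrite divr_ge0 ?sqr_ge0 // !mulr_ge0 // ltW.
Qed.

(** Convexity with a real weight in place of a bundled element of [[0, 1]]. *)
Lemma convex_function_le (R : realType) (E : lmodType R) (f : E -> R) (t : R)
    (x y : E) :
  convex_function [set: E] f -> 0 <= t -> t <= 1 ->
  f (t *: x + (1 - t) *: y) <= t * f x + (1 - t) * f y.
Proof.
move=> fcvx t0 t1.
exact: (fcvx (Itv01 t0 t1) x y (mem_set I) (mem_set I)).
Qed.

(** The excess risk and the empirical loss increase from [bstar] to [b] by
amounts that differ by the increment of the empirical process. *)
Lemma excess_risk_le_of_loss_le (d : measure_display) (T : measurableType d)
    (R : realType) (P : probability T R) (F : lmodType R) (L : F -> T -> R)
    (f0 : F) (p : nat) (psi : 'I_p -> F) (bstar b : 'cV[R]_p) (M e : R) (w : T) :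
  (emp_process_sup P L psi bstar M w <= e%:E)%E ->
  l1norm (b - bstar) <= M ->
  L (lincomb psi b) w <= L (lincomb psi bstar) w ->
  excess_risk P L f0 (lincomb psi b) <=
    excess_risk P L f0 (lincomb psi bstar) + e.
Proof.
move=> supZ bM Lb.
have : (`|emp_process P L psi b w - emp_process P L psi bstar w|%:E <= e%:E)%E.
  by apply: le_trans supZ; apply: ereal_sup_ubound; exists b.
rewrite lee_fin ler_norml /emp_process /excess_risk => /andP[]; lra.
Qed.

(** The arithmetic that fixes the constants 4 and 12. Here [x] and [y] are the
distances of [f_b] and [f_bstar] to [f0], [e] is the excess risk of [f_bstar],
[D] the [l1] distance from [b] to [bstar], and [4 * e + 12 * G] is [eps], that
is [l] times the radius of the ball. Young's inequality with weights 3 and 2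
bounds [l * D] by
[3 G + (5 e + 12 G) / 12 + 2 G + e / 8 <= 6 G + 2 e]. *)
Lemma half_radius_of_margin (R : realFieldType) (c l h x y e D G : R) :
  0 < c -> G = (l * h) ^+ 2 / c -> c * x ^+ 2 <= e + (4 * e + 12 * G) ->
  c * y ^+ 2 <= e -> 0 <= e -> D <= h * (x + y) -> 0 < l ->
  l * D <= (4 * e + 12 * G) / 2.
Proof.
move=> c0 GE cx cy e0 Dh l0.
have h1 : l * D <= l * h * x + l * h * y.
  by rewrite -mulrDr -mulrA ler_pM2l.
have := @young_ineq _ c 3 (l * h) x c0 ltac:(by []).
have := @young_ineq _ c 2 (l * h) y c0 ltac:(by []).
rewrite -GE; lra.
Qed.

Theorem theorem3p1 (R : realType) (d : measure_display) (T : measurableType d)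
    (P : probability T R) (F : lmodType R) (dot : {dot F for idfun})
    (L : F -> T -> R)
    (L_L1 : forall f, P.-integrable [set: T] (EFin \o L f))
    (f0 : F) (f0_min : forall f, risk P L f0 <= risk P L f)
    (p : nat) (psi : 'I_p -> F)
    (bhat : T -> 'cV[R]_p)
    (bhat_min : forall w, nonneg_minimizer L psi w (bhat w))
    (bstar : 'cV[R]_p) (bstar_ge0 : vec_ge0 bstar)
    (* for an empty support, compatibility holds vacuously and the claim fails *)
    (supp_neq0 : supp_vec bstar != finset.set0)
    (L_convex : forall w,
      convex_function [set: 'cV[R]_p] (fun b => L (lincomb psi b) w))
    (c : R) (c_gt0 : 0 < c) (Flocal : set F)
    (margin : quadratic_margin P dot L f0 c Flocal)
    (tau : R) (tau_gt0 : 0 < tau)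
    (eigen : positive_eigenvalue (gram dot psi) tau)
    (phi : R) (phi_gt0 : 0 < phi)
    (compat : compatibility (gram dot psi)
      (3 * max_sqnorm dot psi / tau ^+ 2) (supp_vec bstar) phi)
    (lambda : R) (lambda_gt0 : 0 < lambda) :
  let C := max_sqnorm dot psi in
  let s := #|supp_vec bstar|%:R : R in
  let E := excess_risk P L f0 in
  let fstar := lincomb psi bstar in
  let eps := 4 * E fstar
    + 12 / (c * phi ^+ 2) * (1 + 3 * C / tau ^+ 2) ^+ 2 * s * lambda ^+ 2 in
  let M := eps / lambda in
  (forall b : 'cV[R]_p, l1norm (b - bstar) <= M -> Flocal (lincomb psi b)) ->
  forall w : T, (emp_process_sup P L psi bstar M w <= eps%:E)%E ->
  [/\ l1norm (bhat w - bstar) <= M,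
      M = 4 / lambda * E fstar
        + 12 / (c * phi ^+ 2) * (1 + 3 * C / tau ^+ 2) ^+ 2 * s * lambda,
      E (lincomb psi (bhat w)) <= 5 / 4 * eps
    & 5 / 4 * eps = 5 * E fstar
        + 15 / (c * phi ^+ 2) * (1 + 3 * C / tau ^+ 2) ^+ 2 * s * lambda ^+ 2].

Proof.
move=> C s E fstar eps M local w supZ.
have [bhat0 bhatL] := bhat_min w.
have E0 f : 0 <= E f by rewrite subr_ge0.
have C0 : 0 <= C := max_sqnorm_ge0 dot psi.
set K := 1 + 3 * C / tau ^+ 2 in eps M local supZ *.
have K0 : 0 < K.
  by rewrite ltr_pwDl // divr_ge0 ?sqr_ge0 ?mulr_ge0.
have s0 : 0 < s by rewrite ltr0n card_gt0.
pose h := K * Num.sqrt s / phi.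
have h0 : 0 < h by rewrite divr_gt0 // mulr_gt0 // sqrtr_gt0.
pose G := (lambda * h) ^+ 2 / c.
have G0 : 0 < G.
  by rewrite divr_gt0 // exprn_gt0 // mulr_gt0.
have epsE : eps = 4 * E fstar + 12 * G.
  rewrite /eps /G /h -{1}(sqr_sqrtr (ltW s0)).
  by field; rewrite !gt_eqF.
have eps0 : 0 < eps by have := E0 fstar; rewrite epsE; lra.
have M0 : 0 < M by rewrite divr_gt0.
(* A nonnegative point of the ball that does as well as [bstar] empirically
   lies in the ball of half the radius. *)
have half b : vec_ge0 b -> l1norm (b - bstar) <= M ->
    L (lincomb psi b) w <= L fstar w -> l1norm (b - bstar) <= M / 2.
  move=> b0 bM bL.
  have Eb := excess_risk_le_of_loss_le f0 supZ bM bL.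
  have l1b : l1norm (b - bstar) <= h * (dotnorm dot (lincomb psi b - f0)
                                        + dotnorm dot (fstar - f0)).
    have := l1norm_le_dotnorm (b := b - bstar) supp_neq0 tau_gt0 eigen phi_gt0 compat.
    have pos j : j \notin supp_vec bstar -> 0 <= (b - bstar) j 0.
      by rewrite inE negbK => /eqP bj; rewrite !mxE bj subr0.
    move=> /(_ pos); rewrite -/C -/K -/s mulrC -ler_pdivlMr // => l1b.
    apply: le_trans l1b _; rewrite mulrAC -/h ler_wpM2l //.
      by rewrite divr_ge0 ?mulr_ge0 ?sqrtr_ge0 // ltW.
    rewrite lincombB -/fstar -[lincomb psi b - fstar](subrKA f0).
    apply: le_trans (dotnormD _ _ _) _.
    by rewrite -(dotnormN dot (f0 - fstar)) opprB.
  have starM : l1norm (bstar - bstar) <= M.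
    by rewrite subrr -(scale0r bstar) l1normZ normr0 mul0r ltW.
  have cx := le_trans (margin _ (local _ bM)) Eb; rewrite -/E -/fstar epsE in cx.
  have := half_radius_of_margin c_gt0 (erefl G) cx (margin _ (local _ starM))
    (E0 _) l1b lambda_gt0.
  rewrite -epsE [lambda * _]mulrC -ler_pdivlMr // => /le_trans; apply.
  by rewrite /M mulrAC.
have bhatM : l1norm (bhat w - bstar) <= M.
  set x := l1norm (bhat w - bstar).
  have x0 : 0 <= x := l1norm_ge0 _.
  have Mx : 0 < M + x by rewrite ltr_pwDl.
  pose t := M / (M + x).
  have t0 : 0 < t by rewrite divr_gt0.
  have t1 : t <= 1 by rewrite ler_pdivrMr // mul1r lerDl.
  pose b := t *: bhat w + (1 - t) *: bstar.
  have bE : b - bstar = t *: (bhat w - bstar).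
    by rewrite /b scalerBl scale1r scalerBr addrA addrAC addrK.
  have l1b : l1norm (b - bstar) = t * x.
    by rewrite bE l1normZ gtr0_norm.
  have txE : t * x = M * x / (M + x) by rewrite mulrAC.
  have bM : l1norm (b - bstar) <= M.
    by rewrite l1b txE ler_pdivrMr // ler_wpM2l ?lerDr ?(ltW M0).
  have b0 : vec_ge0 b.
    move=> j; rewrite !mxE addr_ge0 // mulr_ge0 ?subr_ge0 //; exact: ltW.
  have bL : L (lincomb psi b) w <= L fstar w.
    apply: le_trans (convex_function_le (bhat w) bstar (L_convex w) (ltW t0) t1) _.
    have := bhatL _ bstar_ge0; rewrite -/fstar => h1.
    have : t * L (lincomb psi (bhat w)) w <= t * L fstar w by rewrite ler_pM2l.
    lra.
  have := half _ b0 bM bL.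
  rewrite l1b txE ler_pdivrMr // -[M / 2 * _]mulrA ler_pM2l //; lra.
split => //.
- by rewrite /M /eps; field; rewrite !gt_eqF.
- have := excess_risk_le_of_loss_le f0 supZ bhatM (bhatL _ bstar_ge0).
  by rewrite -/E -/fstar => /le_trans; apply; rewrite epsE; lra.
- by rewrite /eps; field; rewrite !gt_eqF.
Qed.
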